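(* $f(n,1)\in\Omega(\sqrt{n})$, i.e. there are a constant $c>0$ and $n_0\in\mathbb{N}$ such that $f(n,1)\ge c\sqrt{n}$ for all integers $n\ge n_0$.
   Context: One-dimensional Hegselmann--Krause (HK) system with strategic agents: there is a set $N=\{1,\dots,n\}$ of non-strategic agents and a disjoint set $S$ of $m=|S|$ strategic agents; $A=N\cup S$. At each discrete time $t\in\mathbb{N}_{\ge 0}$ every agent $i\in A$ has an opinion $x_i(t)\in\mathbb{R}$. The starting opinions $x_i(0)$, $i\in N$, are given. The opinions $x_s(t)$ of the strategic agents $s\in S$ can be chosen freely (as any real numbers) at every time $t$. For $i\in N$, $$x_i(t+1)=\frac{1}{|\mathcal{N}_i(t)|}\sum_{j\in\mathcal{N}_i(t)}x_j(t),\qquad \mathcal{N}_i(t)=\{j\in A: |x_i(t)-x_j(t)|\le 1\}.$$ The system has converged at time $t$ if for all $i,j\in N$ either $x_i(t)=x_j(t)$ or $|x_i(t)-x_j(t)|>1$. The convergence time is the smallest $t\in\mathbb{N}_{\ge 0}$ such that the system has converged at time $t$. For given starting opinions of the non-strategic agents and given $m$, the optimal convergence time is the minimum of the convergence time over all choices of the opinions of the $m$ strategic agents at all times. $f(n,m)$ denotes the supremum of the optimal convergence time over all starting opinions of $n$ non-strategic agents, with $m$ strategic agents. *)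

(* Defs.v *)
From mathcomp Require Import all_boot all_order all_algebra.
From mathcomp Require Import all_classical all_reals all_analysis.

Set Implicit Arguments.
Unset Strict Implicit.
Unset Printing Implicit Defensive.

Import Order.TTheory GRing.Theory Num.Theory.

Local Open Scope classical_set_scope.
Local Open Scope ring_scope.

Section HegselmannKrause.
Variables (R : realType) (n m : nat).

(* The agents are the disjoint union of the non-strategic ones, 'I_n, and the
   strategic ones, 'I_m. *)
Definition opinion (x : 'I_n -> R) (s : 'I_m -> R) (a : 'I_n + 'I_m) : R :=
  match a with inl i => x i | inr k => s k end.

Definition neighbors (x : 'I_n -> R) (s : 'I_m -> R) (i : 'I_n) :
    {set 'I_n + 'I_m} :=
  [set a | `|x i - opinion x s a| <= 1]%SET.

Definition hk_step (x : 'I_n -> R) (s : 'I_m -> R) (i : 'I_n) : R :=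
  (#|neighbors x s i|%:R)^-1 * \sum_(a in neighbors x s i) opinion x s a.

(* A strategy [s] fixes the strategic opinions at all times in advance.
   As the dynamics is deterministic, this is no less general than choosing
   them adaptively. *)
Fixpoint trajectory (x0 : 'I_n -> R) (s : nat -> 'I_m -> R) (t : nat) :
    'I_n -> R :=
  if t is t'.+1 then hk_step (trajectory x0 s t') (s t') else x0.

Definition converged (x : 'I_n -> R) : Prop :=
  forall i j : 'I_n, x i = x j \/ 1 < `|x i - x j|.

(* An infimum of natural numbers in [\bar R] is a minimum, except that the
   infimum of the empty set is [+oo]: a trajectory that never converges has
   convergence time [+oo]. *)
Definition convergence_time (x0 : 'I_n -> R) (s : nat -> 'I_m -> R) : \bar R :=
  ereal_inf [set (t%:R)%:E | t in [set t | converged (trajectory x0 s t)]].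

Definition optimal_convergence_time (x0 : 'I_n -> R) : \bar R :=
  ereal_inf (range (convergence_time x0)).

End HegselmannKrause.

Definition worst_convergence_time (R : realType) (n m : nat) : \bar R :=
  ereal_sup (range (@optimal_convergence_time R n m)).

(* Main.v *)
Require Import Defs.
From mathcomp Require Import all_boot all_order all_algebra.
From mathcomp Require Import all_classical all_reals all_analysis.
From mathcomp Require Import zify lra.

(** Start from the unit path [x_i(0) = i].  An opinion moves by at most 1 per
    step and an agent sitting between two neighbors at distance exactly 1 does
    not move, so disturbances, caused by the ends of the path and by the
    strategic agents, travel at speed at most 2 along the path.  An interval of
    [4t+2] consecutive agents that no strategic opinion enters before time [t]
    therefore still contains two agents at distance 1 at time [t].  Among
    [tm+1] disjoint intervals of this length one is never entered by the [m]
    strategic agents, hence [(tm+1)(4t+2) <= n] excludes convergence at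
    time [t]. *)

Set Implicit Arguments.
Unset Strict Implicit.
Unset Printing Implicit Defensive.

Import Order.TTheory GRing.Theory Num.Theory.

Local Open Scope ring_scope.

Section Dynamics.
Variables (R : realType) (n m : nat).
Implicit Types (x : 'I_n -> R) (s : 'I_m -> R) (i : 'I_n).

Lemma card_neighbors_gt0 x s i : (0 < #|neighbors x s i|)%N.
Proof. by apply/card_gt0P; exists (inl i); rewrite inE /= subrr normr0. Qed.

Lemma hk_step_le x s i : hk_step x s i <= x i + 1.
Proof.
rewrite /hk_step mulrC ler_pdivrMr ?ltr0n ?card_neighbors_gt0//.
rewrite mulr_natr -sumr_const; apply: ler_sum => a; rewrite inE ler_norml.
by move=> /andP[? ?]; lra.
Qed.

Lemma hk_step_ge x s i : x i - 1 <= hk_step x s i.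
Proof.
rewrite /hk_step mulrC ler_pdivlMr ?ltr0n ?card_neighbors_gt0//.
rewrite mulr_natr -sumr_const; apply: ler_sum => a; rewrite inE ler_norml.
by move=> /andP[? ?]; lra.
Qed.

(** The neighborhood is exactly [l], [i], [r], and the mean of [x i - 1], [x i], [x i + 1] is
    [x i]. *)
Lemma hk_step_fixed x s i (l r : 'I_n) :
    x l = x i - 1 -> x r = x i + 1 ->
    (forall j, j != l -> j != i -> j != r -> 1 < `|x i - x j|) ->
    (forall k, 1 < `|x i - s k|) ->
  hk_step x s i = x i.
Proof.
move=> xl xr far_x far_s.
have l_neq_i : l != i by apply/eqP => e; move: xl; rewrite e; lra.
have l_neq_r : l != r by apply/eqP => e; move: xl; rewrite e; lra.
have i_neq_r : i != r by apply/eqP => e; move: xr; rewrite -e; lra.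
have nE : neighbors x s i = [set inl l; inl i; inl r]%SET.
  apply/setP => -[j|k]; rewrite !inE /=; last first.
    by apply/negbTE; rewrite -ltNge.
  have inlE (u v : 'I_n) : (inl u == inl v :> 'I_n + 'I_m) = (u == v) by [].
  rewrite !inlE; have [->|jl] := eqVneq j l.
    by rewrite xl ler_norml; lra.
  have [->|ji] := eqVneq j i; first by rewrite subrr normr0 ler01.
  have [->|jr] := eqVneq j r; first by rewrite xr ler_norml; lra.
  by apply/negbTE; rewrite -ltNge far_x.
have r_notin : inl r \notin [set inl l; inl i : 'I_n + 'I_m]%SET.
  by rewrite !inE negb_or; apply/andP; split; apply/eqP => -[] /eqP;
    rewrite eq_sym ?(negbTE l_neq_r) ?(negbTE i_neq_r).
have l_neq : inl l != inl i :> 'I_n + 'I_m.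
  by apply/eqP => -[] /eqP; rewrite (negbTE l_neq_i).
rewrite /hk_step nE finset.setUC cardsU1 r_notin cards2 l_neq.
rewrite big_setU1//= big_setU1; last by rewrite inE.
rewrite finset.big_set1 /= xl xr -[(1 + _)%N]/3%N.
by lra.
Qed.

End Dynamics.

Section UnitPath.
Variables (R : realType) (n m : nat).

Definition unit_path (i : 'I_n) : R := (i : nat)%:R.

Variable s : nat -> 'I_m -> R.
Let x := trajectory unit_path s.

(** Taking [j = i] pins agent [i] at its starting position. The bounds for all other [j], even
    outside the window, carry the induction: they keep uncontrolled agents from coming within reach
    of [i]. *)
Lemma undisturbed_window (a b t : nat) : (b < n)%N ->
    (forall u k, (u < t)%N -> s u k < a%:R \/ b%:R < s u k) ->
  forall i j : 'I_n, (a + 2 * t <= i)%N -> (i + 2 * t <= b)%N ->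
    ((j <= i)%N -> x t j <= (i : nat)%:R) /\
    ((i <= j)%N -> (i : nat)%:R <= x t j).
Proof.
move=> b_lt_n; elim: t => [|t IH] avoid i j ai ib.
  by rewrite /x /= /unit_path !ler_nat.
have {}IH := IH (fun u k ut => avoid u k (leqW ut)).
have pos (k : 'I_n) : (a + 2 * t <= k)%N -> (k + 2 * t <= b)%N ->
    x t k = (k : nat)%:R.
  move=> ak kb; have [le_k ge_k] := IH k k ak kb.
  by apply/le_anti; rewrite le_k// ge_k.
have l_lt : (i.-1 < n)%N by lia.
have r_lt : (i.+1 < n)%N by lia.
pose l := Ordinal l_lt; pose r := Ordinal r_lt.
(* The predecessor is not truncated, since the window forces [i >= 2]. *)
have lE : (l : nat)%:R = (i : nat)%:R - 1 :> R.
  by rewrite -[in RHS](@prednK i) ?mulrS /=; [lra|lia].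
have rE : (r : nat)%:R = (i : nat)%:R + 1 :> R by rewrite /= mulrS addrC.
have xi : x t i = (i : nat)%:R by apply: pos; lia.
have xl : x t l = (i : nat)%:R - 1 by rewrite -lE; apply: pos => /=; lia.
have xr : x t r = (i : nat)%:R + 1 by rewrite -rE; apply: pos => /=; lia.
have far_s k : 1 < `|x t i - s t k|.
  rewrite xi ltr_normr.
  have ai' : a%:R + 2 <= (i : nat)%:R :> R by rewrite -natrD ler_nat; lia.
  have ib' : (i : nat)%:R + 2 <= b%:R :> R by rewrite -natrD ler_nat; lia.
  by have [?|?] := avoid t k (ltnSn t); apply/orP; [left|right]; lra.
have left_of (k : 'I_n) : (k < i)%N -> x t k <= (i : nat)%:R - 1.
  by move=> ki; rewrite -lE; apply: (IH l k _ _).1 => /=; lia.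
have right_of (k : 'I_n) : (i < k)%N -> (i : nat)%:R + 1 <= x t k.
  by move=> ik; rewrite -rE; apply: (IH r k _ _).2 => /=; lia.
have fixed : hk_step (x t) (s t) i = x t i.
  apply: (@hk_step_fixed _ _ _ _ _ _ l r) => [||k kl ki kr|//]; rewrite xi//.
  have {}kl : (k : nat) != i.-1 by [].
  have {}ki : (k : nat) != i by [].
  have {}kr : (k : nat) != i.+1 by [].
  (* Agents beyond [l] and [r] are held off by the bounds at positions [i - 2] and [i + 2]; this is
     why the window loses two agents per side at each step. *)
  rewrite ltr_normr; apply/orP; have [lt_ki|le_ik] := ltnP k i.
    have : x t k <= (l : nat)%:R - 1.
      pose l' := Ordinal (leq_ltn_trans (leq_pred i.-1) l_lt).
      have <- : (l' : nat)%:R = (l : nat)%:R - 1 :> R.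
        by rewrite -[in RHS](@prednK l) ?mulrS /=; [lra|lia].
      by apply: (IH l' k _ _).1 => /=; lia.
    by left; lra.
  have r'_lt : (i.+2 < n)%N by lia.
  have : (i : nat)%:R + 2 <= x t k.
    rewrite -natrD addn2.
    by apply: (IH (Ordinal r'_lt) k _ _).2 => /=; lia.
  by right; lra.
have xS k : x t.+1 k = hk_step (x t) (s t) k by [].
(* Any other agent is at least 1 away on its side of [i] and moves by at most 1, so it cannot cross
   [i]. *)
split; rewrite leq_eqVlt xS => /orP[/eqP/val_inj eq_ij|lt_ij].
- by rewrite eq_ij fixed xi.
- by apply: le_trans (hk_step_le _ _ _) _; have := left_of j lt_ij; lra.
- by rewrite -eq_ij fixed xi.
- by apply: le_trans (hk_step_ge _ _ _); have := right_of j lt_ij; lra.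
Qed.

(** After [t] steps exactly the two middle agents [a + 2 * t] and [a + 2 * t + 1] are still
    guaranteed in place; their distance 1 is neither 0 nor above 1. *)
Lemma undisturbed_not_converged (a t : nat) : (a + 4 * t + 1 < n)%N ->
    (forall u k, (u < t)%N -> s u k < a%:R \/ (a + 4 * t + 1)%:R < s u k) ->
  ~ converged (x t).
Proof.
move=> b_lt avoid.
have pos (k : 'I_n) : (a + 2 * t <= k)%N -> (k + 2 * t <= a + 4 * t + 1)%N ->
    x t k = (k : nat)%:R.
  move=> ak kb.
  have [le_k ge_k] := undisturbed_window b_lt avoid k ak kb.
  by apply/le_anti; rewrite le_k// ge_k.
have i_lt : (a + 2 * t < n)%N by lia.
have j_lt : (a + 2 * t + 1 < n)%N by lia.
move=> /(_ (Ordinal i_lt) (Ordinal j_lt)).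
rewrite !pos /=; [|lia..].
rewrite [(_ + 1)%:R]natrD opprD addrA subrr add0r normrN normr1.
by move=> [|]; lra.
Qed.

Lemma unit_path_not_converged (t : nat) :
  ((t * m).+1 * (4 * t + 2) <= n)%N -> ~ converged (x t).
Proof.
move=> tmn conv.
pose start (c : 'I_(t * m).+1) : nat := (c * (4 * t + 2))%N.
have visit c : {p : 'I_t * 'I_m |
    (start c)%:R <= s p.1 p.2 <= (start c + 4 * t + 1)%:R}.
  apply: cid; apply: contrapT => no_visit.
  apply: (@undisturbed_not_converged (start c) t) conv.
    by rewrite /start; have := ltn_ord c; nia.
  move=> u k ut; have [?|ge_start] := ltP (s u k) (start c)%:R; first by left.
  right; rewrite ltNge; apply/negP => le_end.
  by apply: no_visit; exists (Ordinal ut, k); rewrite ge_start.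
(* A visit shared by windows [c] and [d] makes each start at most the other's end, hence [c = d].
   Then [t * m + 1] windows would inject into [t * m] pairs of time and strategic agent. *)
have inj : injective (fun c => sval (visit c)).
  move=> c d /= eq_cd; have := svalP (visit c); have := svalP (visit d).
  rewrite -eq_cd => /andP[d1 d2] /andP[c1 c2].
  have := le_trans c1 d2; have := le_trans d1 c2.
  rewrite !ler_nat /start => dc cd; apply/val_inj => /=; nia.
by have := leq_card _ inj; rewrite card_prod !card_ord ltnn.
Qed.

End UnitPath.

Theorem corollary13 (R : realType) :
  exists c : R, 0 < c /\
    exists n0 : nat, forall n : nat, (n0 <= n)%N ->
      ((c * Num.sqrt (n%:R : R))%:E <= worst_convergence_time R n 1)%E.
Proof.
(* With [m = 1] the requirement is [(t + 1) * (4 * t + 2) <= n]. It follows from [16 * t ^ 2 < n]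
   when [t >= 1], as the left side is then at most [12 * t ^ 2]; the case [t = 0] needs [n >= 2]. *)
exists (1 / 4); split; first by lra.
exists 2 => n n_ge2.
apply: le_trans (ereal_sup_ubound _); last by exists (@unit_path R n).
apply/le_ereal_inf_tmp => _ [s _ <-]; apply/le_ereal_inf_tmp => _ [t conv <-].
rewrite lee_fin leNgt; apply/negP => lt_t.
apply: unit_path_not_converged conv.
have : (16 * t ^ 2 < n)%N.
  rewrite -(ltr_nat R) natrM natrX -[ltRHS]sqr_sqrtr ?ler0n//.
  have t_ge0 : 0 <= t%:R :> R by [].
  by nra.
by rewrite muln1; nia.
Qed.
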